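(* Let $\Lambda=(\lambda_{i,j})$ be an optimal hyperplane cover of a $d$-dimensional extremal $(0,1)$-matrix $A$ of order $n$ with deficiency $\delta$. Let $\beta$ be an index with $a_\beta=0$, and suppose there exists an index $\alpha$ covered by $\Lambda$ with weight $1-\delta$ (i.e. $\sum_i\lambda_{i,\alpha_i}=1-\delta$) such that $\lambda_{i,\beta_i}\le\lambda_{i,\alpha_i}$ for all $i=1,\dots,d$. Then the submatrix $A_\beta$ contains a polydiagonal.
   Context: A $d$-dimensional matrix of order $n$ is an array $(a_\alpha)_{\alpha\in\{1,\dots,n\}^d}$; $\mathrm{supp}(A)=\{\alpha:a_\alpha\ne0\}$; the hyperplane $\Gamma_{i,j}$ is the set of indices with $\alpha_i=j$. For an index $\beta$, $A_\beta$ is the $d$-dimensional submatrix of order $n-1$ obtained from $A$ by deleting all hyperplanes containing $\beta$ (i.e. keeping the indices $\gamma$ with $\gamma_i\ne\beta_i$ for all $i$). A polyplex of weight $W$ is a nonnegative matrix $K$ whose entries sum to at most $1$ over each hyperplane and to $W$ in total; a polydiagonal in a matrix of order $m$ is a polyplex of weight $m$. A $(0,1)$-matrix $A$ contains $K$ if $\mathrm{supp}(K)\subseteq\mathrm{supp}(A)$. A hyperplane cover of $A$ is a nonnegative $d\times n$ table $\Lambda$ with $\sum_{i=1}^d\lambda_{i,\alpha_i}\ge1$ for all $\alpha\in\mathrm{supp}(A)$; its weight is the sum of its entries; it is optimal if it has minimum weight among hyperplane covers of $A$. A $(0,1)$-matrix $A$ is extremal if it contains no polydiagonal, but for every index $\alpha$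 with $a_\alpha=0$ the matrix obtained by changing $a_\alpha$ to $1$ contains a polydiagonal. The deficiency of an extremal matrix of order $n$ is $n$ minus the maximum weight of a polyplex contained in it. *)

(* Defs.v *)
From HB Require Import structures.
From mathcomp Require Import all_boot all_order all_algebra.
From mathcomp Require Import reals.
Set Implicit Arguments.
Unset Strict Implicit.
Unset Printing Implicit Defensive.
Import Order.TTheory GRing.Theory Num.Theory.
Local Open Scope ring_scope.

(* Indices are 0-based: {1, ..., n} is represented by 'I_n. *)
Definition mindex (d n : nat) := {ffun 'I_d -> 'I_n}.

Definition dmatrix (R : Type) (d n : nat) := {ffun mindex d n -> R}.

Definition supp (R : realType) (d n : nat) (A : dmatrix R d n)
  : {set mindex d n} := [set a | A a != 0].

Definition hyperplane (d n : nat) (i : 'I_d) (j : 'I_n) : {set mindex d n} :=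
  [set a : mindex d n | a i == j].

(* [lift (b i)] is the increasing bijection of 'I_n.-1 onto the elements of
   'I_n other than [b i]. *)
Definition submatrix (R : realType) (d n : nat) (A : dmatrix R d n)
    (b : mindex d n) : dmatrix R d n.-1 :=
  [ffun c : mindex d n.-1 => A [ffun i => lift (b i) (c i)]].

Definition weight (R : realType) (d n : nat) (K : dmatrix R d n) : R :=
  \sum_a K a.

Definition polyplex (R : realType) (d n : nat) (K : dmatrix R d n) (W : R)
  : Prop :=
  [/\ forall a, 0 <= K a,
      forall i j, \sum_(a in hyperplane i j) K a <= 1
    & weight K = W].

Definition polydiagonal (R : realType) (d n : nat) (K : dmatrix R d n)
  : Prop := polyplex K n%:R.

Definition contains (R : realType) (d n : nat) (A K : dmatrix R d n) : Prop :=
  supp K \subset supp A.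

Definition contains_polydiagonal (R : realType) (d n : nat)
    (A : dmatrix R d n) : Prop :=
  exists K : dmatrix R d n, polydiagonal K /\ contains A K.

Definition zero_one (R : realType) (d n : nat) (A : dmatrix R d n) : Prop :=
  forall a, A a = 0 \/ A a = 1.

Definition set_one (R : realType) (d n : nat) (A : dmatrix R d n)
    (a : mindex d n) : dmatrix R d n :=
  [ffun c => if c == a then 1 else A c].

Definition extremal (R : realType) (d n : nat) (A : dmatrix R d n) : Prop :=
  [/\ zero_one A,
      ~ contains_polydiagonal A
    & forall a, A a = 0 -> contains_polydiagonal (set_one A a)].

Definition max_polyplex_weight (R : realType) (d n : nat)
    (A : dmatrix R d n) (W : R) : Prop :=
  (exists K : dmatrix R d n, polyplex K W /\ contains A K) /\
  (forall (K : dmatrix R d n) (W' : R),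
     polyplex K W' -> contains A K -> W' <= W).

Definition is_deficiency (R : realType) (d n : nat) (A : dmatrix R d n)
    (delta : R) : Prop :=
  exists2 W : R, max_polyplex_weight A W & delta = n%:R - W.

Definition covering_weight (R : realType) (d n : nat) (L : 'M[R]_(d, n))
    (a : mindex d n) : R := \sum_(i < d) L i (a i).

Definition hyperplane_cover (R : realType) (d n : nat) (A : dmatrix R d n)
    (L : 'M[R]_(d, n)) : Prop :=
  (forall i j, 0 <= L i j) /\
  (forall a, a \in supp A -> 1 <= covering_weight L a).

Definition cover_weight (R : realType) (d n : nat) (L : 'M[R]_(d, n)) : R :=
  \sum_(i < d) \sum_(j < n) L i j.

Definition optimal_cover (R : realType) (d n : nat) (A : dmatrix R d n)
    (L : 'M[R]_(d, n)) : Prop :=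
  hyperplane_cover A L /\
  (forall L' : 'M[R]_(d, n),
     hyperplane_cover A L' -> cover_weight L <= cover_weight L').

(* Main.v *)
(* By linear programming duality an optimal cover has weight n - delta.  If K is
   a polydiagonal in A with the zero entry at an index g changed to 1, pairing K
   with the cover gives  delta <= K(g) (1 - Lambda(g)).  For g = alpha this
   forces K(alpha) = 1, so off alpha the support of K avoids all hyperplanes
   through alpha.  Replacing beta_i by alpha_i in coordinate i does not decrease
   covering weights, so the indices in the support of K (which have covering
   weight at least 1) are sent to indices avoiding the hyperplanes through beta
   and of covering weight at least 1; by the same inequality these cannot be
   zeros of A. *)
Require Import Defs.
From mathcomp Require Import all_boot all_order all_algebra.
From mathcomp Require Import perm reals boolp.
From mathcomp Require Import ring lra.
Set Implicit Arguments.
Unset Strict Implicit.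
Unset Printing Implicit Defensive.
Import Order.TTheory GRing.Theory Num.Theory.
Local Open Scope ring_scope.

(** * Farkas' lemma *)

(* Bartl's proof: induction on the number of functionals, subtracting multiples
   of the new functional so that all of them vanish at a point violating the
   conclusion. *)
Lemma farkas (R : realFieldType) (V : lmodType R) (I : eqType) (r : seq I)
    (f : I -> V -> R) (c : V -> R) :
  uniq r -> (forall i, scalar (f i)) -> scalar c ->
  (forall x, (forall i, i \in r -> f i x <= 0) -> c x <= 0) ->
  exists u : I -> R, (forall i, 0 <= u i) /\
    forall x, c x = \sum_(i <- r) u i * f i x.
Proof.
elim: r f c => [|i0 r IH] f c /=.
  move=> _ _ lc hc; exists (fun=> 0); split=> // x; rewrite big_nil.
  have c0 y : c y <= 0 by apply: hc.
  have := lc (-1) x x; rewrite scaleN1r addNr => e1.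
  have := lc 1 0 0; rewrite scale1r addr0 => e0.
  have := lc (-1) x 0; rewrite scaleN1r addr0 => e2.
  have := c0 x; have := c0 (- x); lra.
case/andP=> i0r ur lf lc hc.
have [h|/existsNP[x0 /not_implyP[hx0 cx0]]] :=
    pselect (forall x, (forall i, i \in r -> f i x <= 0) -> c x <= 0).
  have [u [u0 cu]] := IH f c ur lf lc h.
  exists (fun i => if i == i0 then 0 else u i); split=> [i|x].
    by case: ifP.
  rewrite big_cons eqxx mul0r add0r cu; apply: eq_big_seq => i ir.
  by case: eqP => // ii0; rewrite -ii0 ir in i0r.
have {}cx0 : 0 < c x0 by rewrite ltNge; apply/negP.
have fx0 : 0 < f i0 x0.
  rewrite ltNge; apply/negP => f0; have := hc x0; rewrite leNgt cx0.
  by move/(_ _)/negP; apply=> // i; rewrite inE => /predU1P[->|/hx0].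
(* [proj g] is [g] composed with the projection along [x0] onto the kernel of [f i0], so every
   [proj g] vanishes at [x0]. *)
pose t := f i0 x0; pose proj (g : V -> R) x := g x - g x0 / t * f i0 x.
have t0 : t != 0 by rewrite gt_eqF.
have lproj g : scalar g -> scalar (proj g).
  by move=> lg k x y; rewrite /proj lg lf; ring.
have projE g x : scalar g -> proj g x = g (- (f i0 x / t) *: x0 + x).
  by move=> lg; rewrite lg /proj; field.
have [||x hx|u [u0 cu]] := IH (fun i => proj (f i)) (proj c) ur.
- by move=> i; apply: lproj.
- exact: lproj.
- rewrite projE //; apply: hc => i; rewrite inE => /predU1P[->|ir].
    by rewrite lf /= -/t mulNr divfK // addNr.
  by rewrite -projE //; apply: hx.
(* The coefficient of [f i0] is forced by evaluating at [x0], where [c] and [f i0] are positive and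
   the other functionals nonpositive. *)
exists (fun i => if i == i0 then (c x0 - \sum_(i <- r) u i * f i x0) / t
                 else u i); split=> [i|x].
  case: ifP => // _; rewrite divr_ge0 ?ltW // subr_gt0 (le_lt_trans _ cx0) //.
  by rewrite big_seq sumr_le0 // => j jr; rewrite mulr_ge0_le0 ?hx0.
rewrite big_cons eqxx.
have -> : \sum_(j <- r) (if j == i0 then (c x0 - \sum_(i <- r) u i * f i x0) / t
    else u j) * f j x = \sum_(j <- r) u j * f j x.
  apply: eq_big_seq => i ir.
  by case: eqP => // ii0; rewrite -ii0 ir in i0r.
have := cu x; rewrite {1}/proj.
have -> : \sum_(j <- r) u j * proj (f j) x =
    \sum_(j <- r) u j * f j x - (\sum_(j <- r) u j * f j x0) / t * f i0 x.
  rewrite !mulr_suml -sumrB; apply: eq_bigr => j _; rewrite /proj; ring.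
move=> e; have -> : c x = (c x - c x0 / t * f i0 x) + c x0 / t * f i0 x by ring.
by rewrite e; ring.
Qed.

(** * Pairing matrices with covers *)

Section Covers.
Variables (R : realType) (d n : nat).
Implicit Types (A K : dmatrix R d n) (L : 'M[R]_(d, n)) (a b : mindex d n).

Lemma sum_hyperplane K (i : 'I_d) :
  \sum_j \sum_(a in hyperplane i j) K a = weight K.
Proof.
rewrite /weight (partition_big (fun a : mindex d n => a i) xpredT) //=.
by apply: eq_bigr => j _; apply: eq_bigl => a; rewrite inE.
Qed.

(** The [n] parallel hyperplane sums are at most 1 and add up to [n], so none has slack. *)
Lemma polydiagonal_hyperplane K i j :
  polydiagonal K -> \sum_(a in hyperplane i j) K a = 1.
Proof.
move=> [K0 K1 wK].
have /eqP := sum_hyperplane K i; rewrite wK -subr_eq0 -oppr_eq0 opprB.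
have -> : n%:R = \sum_(j < n) (1 : R) by rewrite sumr_const card_ord.
rewrite -sumrB psumr_eq0 => [|k _]; last by rewrite subr_ge0.
by move=> /allP/(_ j (mem_index_enum _)) /=; rewrite subr_eq0 => /eqP.
Qed.

Lemma le_hyperplane K a i :
  (forall c, 0 <= K c) -> K a <= \sum_(c in hyperplane i (a i)) K c.
Proof.
move=> K0; rewrite (bigD1 a) ?inE //= lerDl sumr_ge0 //.
Qed.

Lemma sum_covering_weight K L :
  \sum_a K a * covering_weight L a =
  \sum_i \sum_j L i j * \sum_(a in hyperplane i j) K a.
Proof.
under eq_bigr => a _ do rewrite /covering_weight mulr_sumr.
rewrite exchange_big; apply: eq_bigr => i _ /=.
rewrite (partition_big (fun a : mindex d n => a i) xpredT) //=.
apply: eq_bigr => j _; rewrite mulr_sumr.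
apply: eq_big => [a|a /eqP <-]; [by rewrite inE | by rewrite mulrC].
Qed.

Lemma scalar_covering_weight a : scalar (fun L => covering_weight L a).
Proof.
move=> k L L'; rewrite /covering_weight mulr_sumr -big_split.
by apply: eq_bigr => i _; rewrite !mxE.
Qed.

Lemma scalar_cover_weight : scalar (@cover_weight R d n).
Proof.
move=> k L L'; rewrite /cover_weight mulr_sumr -big_split.
apply: eq_bigr => i _; rewrite mulr_sumr -big_split.
by apply: eq_bigr => j _; rewrite !mxE.
Qed.

Lemma covering_weight_delta i j a :
  covering_weight (delta_mx i j : 'M[R]_(d, n)) a = (a i == j)%:R.
Proof.
rewrite /covering_weight (bigD1 i) //= mxE eqxx /= big1 ?addr0 // => k ki.
by rewrite mxE (negPf ki).
Qed.

Lemma cover_weight_delta i j : cover_weight (delta_mx i j : 'M[R]_(d, n)) = 1.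
Proof.
rewrite /cover_weight (bigD1 i) //= (bigD1 j) //= mxE !eqxx.
rewrite !big1 ?addr0 // => [k ki|k kj].
  by apply: big1 => l _; rewrite mxE (negPf ki).
by rewrite mxE (negPf kj) andbF.
Qed.

(** * Linear programming duality *)

(* Farkas' lemma is applied to the homogenized covering problem in (L, t), where
   L / t is the cover: the constraint [None] bounds its weight, [Some (inl _)]
   says that it is nonnegative and [Some (inr _)] that it covers an index. *)
Lemma exists_cover_le A W (i0 : 'I_d) : zero_one A ->
  (forall K W', polyplex K W' -> contains A K -> W' <= W) ->
  exists2 L, hyperplane_cover A L & cover_weight L <= W.
Proof.
move=> A01 hW; apply: contrapT => nex.
pose V : lmodType R := ('M[R]_(d, n) * R^o)%type.
pose f (k : option ('I_d * 'I_n + mindex d n)) (x : V) : R :=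
  match k with
  | None => cover_weight x.1 - W * x.2
  | Some (inl p) => - x.1 p.1 p.2
  | Some (inr a) => A a * (x.2 - covering_weight x.1 a)
  end.
have lf k : scalar (f k).
  move=> l [L t] [L' t']; case: k => [[p|a]|] /=.
  - by rewrite !mxE; ring.
  - by rewrite scalar_covering_weight /GRing.scale /=; ring.
  - by rewrite scalar_cover_weight /GRing.scale /=; ring.
have lc : scalar (fun x : V => x.2 : R) by [].
have [|u [u0 cu]] := farkas (index_enum_uniq _) lf lc.
  (* A solution with [t > 0] would rescale to a cover of weight at most [W]. *)
  move=> [L t] h /=; rewrite leNgt; apply/negP => t0; apply: nex.
  have {}h k : f k (L, t) <= 0 by apply: h; apply: mem_index_enum.
  have cE a : covering_weight (t^-1 *: L) a = t^-1 * covering_weight L a.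
    by rewrite /covering_weight mulr_sumr; apply: eq_bigr => i _; rewrite mxE.
  exists (t^-1 *: L); first split=> [i j|a].
  - rewrite mxE mulr_ge0 ?invr_ge0 ?(ltW t0) //.
    by have := h (Some (inl (i, j))); rewrite /= oppr_le0.
  - rewrite inE => Aa; rewrite cE mulrC ler_pdivlMr // mul1r.
    have := h (Some (inr a)); rewrite /=; case: (A01 a) => Ea.
      by rewrite Ea eqxx in Aa.
    by rewrite Ea mul1r subr_le0.
  have -> : cover_weight (t^-1 *: L) = t^-1 * cover_weight L.
    rewrite /cover_weight mulr_sumr; apply: eq_bigr => i _.
    by rewrite mulr_sumr; apply: eq_bigr => j _; rewrite mxE.
  rewrite mulrC ler_pdivrMr //.
  by have := h None; rewrite /= subr_le0.
(* The multipliers of the covering constraints form the dual solution; the factor [A a] confines its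
   support to that of [A]. *)
pose s := u None; pose K : dmatrix R d n := [ffun a => u (Some (inr a)) * A a].
have s0 : 0 <= s by apply: u0.
have K0 a : 0 <= K a.
  by rewrite ffunE mulr_ge0 //; case: (A01 a) => ->.
have sumE (x : V) : \sum_k u k * f k x = s * f None x +
    (\sum_p u (Some (inl p)) * - x.1 p.1 p.2 +
     \sum_a K a * (x.2 - covering_weight x.1 a)).
  rewrite (bigD1 None) //=; congr (_ + _).
  rewrite (reindex_omap Some id) /=; last by case.
  rewrite (eq_bigl xpredT) => [|k]; last by rewrite eqxx.
  rewrite big_sumType /=; congr (_ + _).
  by apply: eq_bigr => a _; rewrite ffunE mulrA.
(* Evaluate the Farkas identity at [(0, 1)]. *)
have wK : weight K = 1 + s * W.
  have := cu (0, 1); rewrite sumE /=.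
  have -> : cover_weight (0 : 'M[R]_(d, n)) = 0.
    by rewrite /cover_weight big1 // => i _; rewrite big1 // => j _; rewrite mxE.
  rewrite big1 ?add0r => [|p _]; last by rewrite mxE oppr0 mulr0.
  have -> : \sum_a K a * (1 - covering_weight (0 : 'M[R]_(d, n)) a) = weight K.
    apply: eq_bigr => a _; rewrite /covering_weight big1 ?subr0 ?mulr1 //.
    by move=> i _; rewrite mxE.
  by rewrite mulr1 mulrN => ->; ring.
(* Evaluate at a unit table with [t = 0]; the multipliers of the sign constraints only help. *)
have hK i j : \sum_(a in hyperplane i j) K a <= s.
  have := cu (delta_mx i j, 0); rewrite sumE /= cover_weight_delta.
  have -> : \sum_a K a * (0 - covering_weight (delta_mx i j) a) =
      - \sum_(a in hyperplane i j) K a.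
    rewrite (big_mkcond (fun a => a \in _)) -sumrN; apply: eq_bigr => a _.
    rewrite covering_weight_delta inE.
    by case: eqP; rewrite sub0r ?mulrN ?mulr1 // oppr0 mulr0 oppr0.
  have : \sum_p u (Some (inl p)) * - (delta_mx i j : 'M[R]_(d, n)) p.1 p.2 <= 0.
    apply: sumr_le0 => p _; rewrite mulr_ge0_le0 // oppr_le0 mxE.
    exact: ler0n.
  by lra.
have [s00|s00] := eqVneq s 0.
  have : weight K <= 0.
    rewrite -(sum_hyperplane K i0); apply: sumr_le0 => j _.
    by rewrite (le_trans (hK i0 j)) ?s00.
  by rewrite wK s00 mul0r addr0 leNgt ltr01.
have sp : 0 < s by rewrite lt_def s00.
(* Scaling by [s^-1] gives a polyplex of weight [W + s^-1], above the maximum. *)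
pose K1 : dmatrix R d n := [ffun a => s^-1 * K a].
have : s^-1 * weight K <= W.
  apply: (hW K1).
    split=> [a|i j|].
    - by rewrite ffunE mulr_ge0 // invr_ge0.
    - under eq_bigr do rewrite ffunE.
      by rewrite -mulr_sumr mulrC ler_pdivrMr // mul1r.
    - by rewrite /weight mulr_sumr; apply: eq_bigr => a _; rewrite ffunE.
  apply/subsetP => a; rewrite !inE !ffunE.
  by apply: contra_neq => ->; rewrite !mulr0.
by rewrite mulrC ler_pdivrMr // wK; lra.
Qed.

(** * Polydiagonals after changing one entry *)

Lemma contains_set_one A K a c :
  contains (set_one A a) K -> K c != 0 -> c != a -> c \in supp A.
Proof.
move=> /subsetP/(_ c); rewrite !inE ffunE => h Kc ca.
by have := h Kc; rewrite (negPf ca).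
Qed.

(** The left side is the sum of [K c * (1 - covering_weight L c)] over all [c]; terms with [c != a]
    are nonpositive, as [K] lives there on covered indices. *)
Lemma set_one_entry_ge A L K a :
  hyperplane_cover A L -> polydiagonal K -> contains (set_one A a) K ->
  n%:R - cover_weight L <= K a * (1 - covering_weight L a).
Proof.
move=> [_ cL] pK AK.
have e : \sum_c K c * covering_weight L c = cover_weight L.
  rewrite sum_covering_weight; apply: eq_bigr => i _; apply: eq_bigr => j _.
  by rewrite polydiagonal_hyperplane // mulr1.
have [K0 _ wK] := pK.
rewrite -wK -e /weight -sumrB (bigD1 a) //=.
have -> : K a - K a * covering_weight L a = K a * (1 - covering_weight L a).
  by ring.
rewrite gerDl; apply: sumr_le0 => c ca.
have [->|Kc] := eqVneq (K c) 0; first by rewrite mul0r subr0.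
have -> : K c - K c * covering_weight L c = K c * (1 - covering_weight L c).
  by ring.
by rewrite mulr_ge0_le0 // subr_le0 cL // (contains_set_one AK).
Qed.

(* The bijection from the indices of a submatrix avoiding [b] onto the indices
   avoiding [a], exchanging [a i] and [b i] in each coordinate. *)
Definition avoid a b (c : mindex d n.-1) : mindex d n :=
  [ffun i => tperm (a i) (b i) (lift (b i) (c i))].

Lemma avoid_inj a b : injective (avoid a b).
Proof.
move=> c c' /ffunP e; apply/ffunP => i; have := e i.
by rewrite !ffunE => /perm_inj/lift_inj.
Qed.

Lemma sum_avoid K a b (S : {set mindex d n.-1}) :
  \sum_(g in avoid a b @: S) K g = \sum_(c in S) K (avoid a b c).
Proof. by apply: big_imset => c c' _ _; apply: avoid_inj. Qed.

Lemma avoid_image a b :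
  avoid a b @: setT = [set c : mindex d n | [forall i, c i != a i]].
Proof.
apply/setP => g; rewrite inE; apply/imsetP/forallP => [[c _ ->] i|h].
  rewrite ffunE -[X in _ != X](tpermR (a i) (b i)) (inj_eq perm_inj) eq_sym.
  exact: neq_lift.
have /fin_all_exists[c hc] i :
    exists k, tperm (a i) (b i) (g i) = lift (b i) k.
  have : b i != tperm (a i) (b i) (g i).
    by rewrite -[X in X != _](tpermL (a i) (b i)) (inj_eq perm_inj) eq_sym.
  by case/unlift_some => k -> _; exists k.
exists [ffun i => c i] => //; apply/ffunP => i.
by rewrite !ffunE -hc tpermK.
Qed.

End Covers.

Theorem theorem7p4 (R : realType) (d n : nat) (A : dmatrix R d n)
    (L : 'M[R]_(d, n)) (delta : R) (b : mindex d n)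
    (hA : extremal A) (hdelta : is_deficiency A delta)
    (hL : optimal_cover A L) (hb : A b = 0)
    (hab : exists a : mindex d n,
       covering_weight L a = 1 - delta /\
       forall i : 'I_d, L i (b i) <= L i (a i)) :
  contains_polydiagonal (submatrix A b).
Proof.
have [A01 nA exA] := hA; have [W [[K [pK AK]] maxW] dE] := hdelta.
have [cL optL] := hL; have [a [La Lba]] := hab.
have [d0|d0] := posnP d.
  (* The only index is [b], so [A] is zero and [delta = n]; the hypothesis on
     [a] then reads [0 = 1 - n]. *)
  move: A L b a K hA hdelta hL hb hab A01 nA exA pK AK maxW cL optL La Lba.
  rewrite d0 => A L b a K _ _ _ hb _ _ _ _ [_ _ wK] AK _ _ _ La _.
  have K0 c : K c = 0.
    apply/eqP; apply: contraTT AK => Kc; apply/subsetPn; exists c; rewrite ?inE //.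
    by have -> : c = b by [apply/ffunP; case]; rewrite hb eqxx.
  have W0 : W = 0 by rewrite -wK /weight big1.
  have n1 : n = 1%N.
    apply/eqP; rewrite -(eqr_nat R) -subr_eq0 -oppr_eq0 opprB.
    by move: La; rewrite dE W0 subr0 /covering_weight big_ord0 => <-.
  (* The submatrix has order 0, so weight 0 suffices. *)
  exists [ffun=> 0]; split; first split=> [c|[] //|].
  - by rewrite ffunE.
  - by rewrite /weight big1 ?n1 // => c _; rewrite ffunE.
  - by apply/subsetP => c; rewrite inE ffunE eqxx.
pose i0 := Ordinal d0.
have wL : cover_weight L <= n%:R - delta.
  have [L' cL' wL'] := exists_cover_le i0 A01 maxW.
  by rewrite (le_trans (optL _ cL')) // dE opprB addrC subrK.
(* Otherwise the maximum polyplex [K] would have weight exactly [n]. *)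
have d_gt0 : 0 < delta.
  rewrite ltNge; apply/negP => dle0; apply: nA; exists K; split=> //.
  have [K0 K1 wK] := pK; split=> //; apply/le_anti/andP; split.
    rewrite -(sum_hyperplane K i0) (le_trans (ler_sum _ (fun j _ => K1 i0 j))) //.
    by rewrite sumr_const card_ord.
  by rewrite wK; move: dle0; rewrite dE; lra.
have zeroA c : c \notin supp A -> A c = 0 by rewrite inE negbK => /eqP.
have Aa : A a = 0.
  by apply: zeroA; apply/negP => /(proj2 cL); rewrite La; lra.
have [P [pP AP]] := exA a Aa; have [P0 P1 wP] := pP.
have Pa : P a = 1.
  apply/le_anti/andP; split; first exact: le_trans (le_hyperplane a i0 P0) _.
  have := set_one_entry_ge cL pP AP; rewrite La.
  have -> : P a * (1 - (1 - delta)) = P a * delta by ring.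
  move=> h; rewrite -(ler_pM2r d_gt0) mul1r (le_trans _ h) //; lra.
(* The entry [P a = 1] already fills every hyperplane through [a]. *)
have Pavoid c i : c != a -> c i = a i -> P c = 0.
  move=> ca cai; apply/le_anti/andP; split=> //.
  have := P1 i (a i); rewrite (bigD1 a) ?inE //= Pa (bigD1 c) ?inE ?cai ?eqxx //=.
  have : 0 <= \sum_(k in hyperplane i (a i) | (k != a) && (k != c)) P k.
    exact: sumr_ge0.
  under [X in _ + (_ + X) <= _]eq_bigl do rewrite -andbA.
  by lra.
exists [ffun c => P (avoid a b c)]; split; first split=> [c|i j|].
- by rewrite ffunE.
(* [avoid a b] maps each hyperplane of the submatrix into a single hyperplane of [A]. *)
- apply: le_trans (P1 i (tperm (a i) (b i) (lift (b i) j))).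
  under eq_bigr do rewrite ffunE.
  rewrite -sum_avoid.
  rewrite [leRHS](big_setID (avoid a b @: hyperplane i j)) /=.
  rewrite (setIidPr _) ?lerDl ?sumr_ge0 //.
  apply/subsetP => g /imsetP[c]; rewrite !inE => /eqP <- ->.
  by rewrite ffunE.
- rewrite /weight; under eq_bigr do rewrite ffunE.
  have n_gt0 : (0 < n)%N by apply: leq_ltn_trans (ltn_ord (b i0)).
  have -> : n.-1%:R = weight P - P a.
    by rewrite wP Pa -[in RHS](prednK n_gt0) -natr1 addrK.
  (* Off [a], all the mass of [P] lies in the image of [avoid a b]. *)
  rewrite -(eq_bigl _ _ (@in_setT _)) -sum_avoid.
  rewrite avoid_image /weight [in RHS](bigD1 a) //= [RHS]addrC addrA addNr add0r.
  rewrite [RHS](bigID (mem [set c : mindex d n | [forall i, c i != a i]])) /=.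
  rewrite [X in _ + X]big1 ?addr0 => [|c /andP[ca]].
    apply: eq_bigl => c; rewrite inE andb_idl // => /forallP/(_ i0).
    by apply: contra_neq => ->.
  by rewrite inE => /forallPn[i /negPn/eqP]; apply: Pavoid.
- apply/subsetP => c; rewrite !inE !ffunE => Pc.
  set g := avoid a b c; set g' := [ffun i => _].
  have ga i : g i != a i.
    have : g \in avoid a b @: setT by apply: imset_f.
    by rewrite avoid_image inE => /forallP.
  have g_ge1 : 1 <= covering_weight L g.
    apply: (proj2 cL); apply: contains_set_one AP Pc _.
    by apply: contra_neq (ga i0) => <-.
  have g'_ge1 : 1 <= covering_weight L g'.
    (* [g] and [g'] differ only in coordinates where [g] has [b i] and [g'] has [a i]. *)
    apply: le_trans g_ge1 _; apply: ler_sum => i _; rewrite !ffunE.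
    case: tpermP => [->|e|//]; first exact: Lba.
    by have := neq_lift (b i) (c i); rewrite e eqxx.
  (* If [g'] were a zero of [A], the entry bound would give [delta <= 0]. *)
  apply/eqP => Ag'; have [Q [pQ AQ]] := exA g' Ag'; have [Q0 _ _] := pQ.
  have := set_one_entry_ge cL pQ AQ.
  have : Q g' * (1 - covering_weight L g') <= 0.
    by rewrite mulr_ge0_le0 // subr_le0.
  by lra.
Qed.
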